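(* Let $A\in\mathbb{R}^{n\times n}$ be such that, for every $j\in\{1,\dots,q\}$, $\Lambda_j$ is real or $\Lambda_j$ is complex. Let $y_0\in\mathbb{R}^n$ and unit $\hat z_0\in\mathbb{R}^n$ with $w^{(1)}y_0\ne0$ and $w^{(1)}\hat z_0\neq0$. Then, for every $t$ with $\epsilon(t,\hat y_0)<1$, $$K(t,y_0,\hat z_0)\approx K_\infty(t,y_0,\hat z_0)\ \text{with precision}\ \frac{\epsilon(t,\hat z_0)+\epsilon(t,\hat y_0)}{1-\epsilon(t,\hat y_0)},\qquad K(t,y_0)\approx K_\infty(t,y_0)\ \text{with precision}\ \frac{\epsilon(t)+\epsilon(t,\hat y_0)}{1-\epsilon(t,\hat y_0)},$$ where for $u\in\{\hat y_0,\hat z_0\}$ $$\epsilon(t,u)=\sum_{j=2}^q e^{(r_j-r_1)t}\frac{f_j}{f_1}\cdot\frac{|\hat w^{(j)}u|}{|\hat w^{(1)}u|}G_j(t,u),\qquad \epsilon(t)=\sum_{j=2}^q e^{(r_j-r_1)t}\frac{f_j}{f_1}G_j(t),$$ and $G_j$ is given by: (1) if $\Lambda_j,\Lambda_1$ both real, $G_j(t,u)=G_j(t)=1$; (2) if $\Lambda_j$ complex, $\Lambda_1$ real, $G_j(t,u)=2\|\hat\Theta_j(t,u)\|$, $G_j(t)=2\|\hat\Theta_j(t)\|$; (3) if $\Lambda_j$ real, $\Lambda_1$ complex, $G_j(t,u)=1/(2\|\hat\Theta_1(t,u)\|)$, $G_j(t)=1/(2\|\hat\Theta_1(t)\|)$;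 (4) if both complex, $G_j(t,u)=\|\hat\Theta_j(t,u)\|/\|\hat\Theta_1(t,u)\|$, $G_j(t)=\|\hat\Theta_j(t)\|/\|\hat\Theta_1(t)\|$.
   Context: $\|\cdot\|$ is a vector norm on $\mathbb{C}^n$, used on $\mathbb{R}^n$ by restriction; real matrices have the norm induced over real vectors; for a row $w$, $\|w\|=\max_{\|u\|=1}|wu|$ (over $\mathbb{R}^n$ for real $w$, over $\mathbb{C}^n$ for complex $w$). $\hat y_0=y_0/\|y_0\|$, $K(t,y_0,\hat z_0)=\|e^{tA}\hat z_0\|/\|e^{tA}\hat y_0\|$, $K(t,y_0)=\|e^{tA}\|/\|e^{tA}\hat y_0\|$. Let $r_1>r_2>\dots>r_q$ be the distinct real parts of the eigenvalues of $A$ and $\Lambda_j$ the set of eigenvalues with real part $r_j$. $\Lambda_j$ is real if it consists of one real simple eigenvalue $\lambda_j$; $\Lambda_j$ is complex if it consists exactly of a pair of simple complex conjugate eigenvalues $\lambda_j,\overline{\lambda_j}$ with $\omega_j=\operatorname{Im}\lambda_j>0$. In either case $w^{(j)}$ (row) and $v^{(j)}$ (column) are left and right eigenvectors for $\lambda_j$ (real in the real case), $\hat w^{(j)}=w^{(j)}/\|w^{(j)}\|$, $\hat v^{(j)}=v^{(j)}/\|v^{(j)}\|$, and $f_j=\|w^{(j)}\|\,\|v^{(j)}\|$. For complex $\Lambda_j$: polar forms $\hat v^{(j)}_k=|\hat v^{(j)}_k|e^{\sqrt{-1}\alpha_{jk}}$, $\hat w^{(j)}_l=|\hat w^{(j)}_l|e^{\sqrt{-1}\beta_{jl}}$,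 $\hat w^{(j)}u=|\hat w^{(j)}u|e^{\sqrt{-1}\gamma_j(u)}$ ($u\in\mathbb{R}^n$), $\hat\Theta_j(t,u)=(|\hat v^{(j)}_k|\cos(\omega_jt+\alpha_{jk}+\gamma_j(u)))_{k=1}^n$, $\hat\Theta_j(t)=(|\hat v^{(j)}_k||\hat w^{(j)}_l|\cos(\omega_jt+\alpha_{jk}+\beta_{jl}))_{k,l=1}^n$. Asymptotic condition numbers: if $\Lambda_1$ is real, $K_\infty(t,y_0,\hat z_0)=|\hat w^{(1)}\hat z_0|/|\hat w^{(1)}\hat y_0|$ and $K_\infty(t,y_0)=1/|\hat w^{(1)}\hat y_0|$; if $\Lambda_1$ is complex, $K_\infty(t,y_0,\hat z_0)=\frac{|\hat w^{(1)}\hat z_0|}{|\hat w^{(1)}\hat y_0|}\cdot\frac{\|\hat\Theta_1(t,\hat z_0)\|}{\|\hat\Theta_1(t,\hat y_0)\|}$ and $K_\infty(t,y_0)=\frac{1}{|\hat w^{(1)}\hat y_0|}\cdot\frac{\|\hat\Theta_1(t)\|}{\|\hat\Theta_1(t,\hat y_0)\|}$. For $a,b\in\mathbb{R}$, $\epsilon\ge0$: ''$a\approx b$ with precision $\epsilon$'' means $a=b(1+\chi)$ with $|\chi|\le\epsilon$.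
   Formalization: The left and right eigenvectors are additionally assumed to be normalized by w^(j) v^(j) = 1 for every j; without this normalization f_j (and the angles in the complex case) depend on the scaling of the eigenvectors and the stated precision fails. *)

(* Defs.v *)
From HB Require Import structures.
From mathcomp Require Import all_boot all_order all_algebra complex.
From mathcomp Require Import all_classical all_reals all_analysis.
Set Implicit Arguments. Unset Strict Implicit. Unset Printing Implicit Defensive.
Import Order.TTheory GRing.Theory Num.Theory.
Local Open Scope ring_scope.
Local Open Scope classical_set_scope.

Section Defs.
Variable R : realType.
Local Notation C := R[i].

Definition cmod (z : C) : R := Num.sqrt (@complex.Re R z ^+ 2 + @complex.Im R z ^+ 2).
Definition cconj (z : C) : C := Complex (@complex.Re R z) (- @complex.Im R z).
Definition cexpi (th : R) : C := Complex (cos th) (sin th).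
Definition toC (x : R) : C := Complex x 0.

Variable n : nat.

Definition vC (u : 'cV[R]_n) : 'cV[C]_n := map_mx toC u.
Definition mC (M : 'M[R]_n) : 'M[C]_n := map_mx toC M.

Definition is_vnorm (nu : 'cV[C]_n -> R) : Prop :=
  [/\ forall u, 0 <= nu u,
      forall u, nu u = 0 -> u = 0,
      forall (c : C) u, nu (c *: u) = cmod c * nu u &
      forall u v, nu (u + v) <= nu u + nu v].

Definition nuR (nu : 'cV[C]_n -> R) (u : 'cV[R]_n) : R := nu (vC u).

Definition mnorm (nu : 'cV[C]_n -> R) (M : 'M[R]_n) : R :=
  sup [set nuR nu (M *m u) | u in [set u : 'cV[R]_n | nuR nu u = 1]].

Definition rdot (w : 'rV[C]_n) (u : 'cV[C]_n) : C := (w *m u) 0 0.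

Definition is_real_row (w : 'rV[C]_n) : bool := [forall k, @complex.Im R (w 0 k) == 0].

Definition rnorm (nu : 'cV[C]_n -> R) (w : 'rV[C]_n) : R :=
  if is_real_row w then
    sup [set cmod (rdot w (vC u)) | u in [set u : 'cV[R]_n | nuR nu u = 1]]
  else
    sup [set cmod (rdot w u) | u in [set u : 'cV[C]_n | nu u = 1]].

Definition expm (t : R) (A : 'M[R]_n) : 'M[R]_n :=
  \matrix_(i, j) limn (fun N : nat =>
      \sum_(k < N) (t ^+ k / (k`!)%:R) * (A ^+ k) i j).

Definition approx_prec (a b eps : R) : Prop :=
  exists chi : R, a = b * (1 + chi) /\ `|chi| <= eps.

(* Lambda_j = set of eigenvalues of A with real part rj *)
Definition Lambda_real (A : 'M[R]_n) (rj : R) (l : C) : Prop :=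
  [/\ @complex.Im R l = 0,
      mup l (char_poly (mC A)) = 1%N &
      forall mu : C, (eigenvalue (mC A) mu /\ @complex.Re R mu = rj) <-> mu = l].

Definition Lambda_complex (A : 'M[R]_n) (rj : R) (l : C) : Prop :=
  [/\ 0 < @complex.Im R l,
      mup l (char_poly (mC A)) = 1%N,
      mup (cconj l) (char_poly (mC A)) = 1%N &
      forall mu : C, (eigenvalue (mC A) mu /\ @complex.Re R mu = rj) <->
                     (mu = l \/ mu = cconj l)].

Definition hatw nu (w : 'rV[C]_n) : 'rV[C]_n := (toC (rnorm nu w))^-1 *: w.
Definition hatv nu (v : 'cV[C]_n) : 'cV[C]_n := (toC (nu v))^-1 *: v.

(* Theta-hat_j(t,u) and Theta-hat_j(t), given the polar angles
   alpha_k (of hat v_k), beta_l (of hat w_l), gamma (of hat w u) and omega *)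
Definition Theta_u (vh : 'cV[C]_n) (alpha : 'I_n -> R) (om gam t : R)
  : 'cV[R]_n := \col_k (cmod (vh k 0) * cos (om * t + alpha k + gam)).
Definition Theta_m (vh : 'cV[C]_n) (wh : 'rV[C]_n) (alpha beta : 'I_n -> R)
  (om t : R) : 'M[R]_n :=
  \matrix_(k, l) (cmod (vh k 0) * cmod (wh 0 l) * cos (om * t + alpha k + beta l)).

End Defs.

Section Quantities.
Variables (R : realType) (n : nat).
Local Notation C := R[i].
Variables (nu : 'cV[C]_n -> R) (A : 'M[R]_n) (q : nat) (r : nat -> R)
  (lam : nat -> C) (w : nat -> 'rV[C]_n) (v : nat -> 'cV[C]_n)
  (alpha beta : nat -> 'I_n -> R) (gamma : nat -> 'cV[R]_n -> R).

Definition unitv (u : 'cV[R]_n) : 'cV[R]_n := (nuR nu u)^-1 *: u.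

Definition fcond (j : nat) : R := rnorm nu (w j) * nu (v j).
Definition omega (j : nat) : R := complex.Im (lam j).
Definition is_cplx (j : nat) : bool := 0 < complex.Im (lam j).

Definition whu (j : nat) (u : 'cV[R]_n) : C := rdot (hatw nu (w j)) (vC u).

Definition Th_u (j : nat) (t : R) (u : 'cV[R]_n) : 'cV[R]_n :=
  Theta_u (hatv nu (v j)) (alpha j) (omega j) (gamma j u) t.
Definition Th_m (j : nat) (t : R) : 'M[R]_n :=
  Theta_m (hatv nu (v j)) (hatw nu (w j)) (alpha j) (beta j) (omega j) t.

Definition G_u (j : nat) (t : R) (u : 'cV[R]_n) : R :=
  match is_cplx j, is_cplx 1 with
  | false, false => 1
  | true, false => 2 * nuR nu (Th_u j t u)
  | false, true => 1 / (2 * nuR nu (Th_u 1 t u))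
  | true, true => nuR nu (Th_u j t u) / nuR nu (Th_u 1 t u)
  end.
Definition G_m (j : nat) (t : R) : R :=
  match is_cplx j, is_cplx 1 with
  | false, false => 1
  | true, false => 2 * mnorm nu (Th_m j t)
  | false, true => 1 / (2 * mnorm nu (Th_m 1 t))
  | true, true => mnorm nu (Th_m j t) / mnorm nu (Th_m 1 t)
  end.

Definition eps_u (t : R) (u : 'cV[R]_n) : R :=
  \sum_(2 <= j < q.+1) expR ((r j - r 1) * t) * (fcond j / fcond 1)
     * (cmod (whu j u) / cmod (whu 1 u)) * G_u j t u.
Definition eps_m (t : R) : R :=
  \sum_(2 <= j < q.+1) expR ((r j - r 1) * t) * (fcond j / fcond 1) * G_m j t.

Definition Kz (t : R) (y0 z0 : 'cV[R]_n) : R :=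
  nuR nu (expm t A *m z0) / nuR nu (expm t A *m unitv y0).
Definition Km (t : R) (y0 : 'cV[R]_n) : R :=
  mnorm nu (expm t A) / nuR nu (expm t A *m unitv y0).

Definition Kinf_z (t : R) (y0 z0 : 'cV[R]_n) : R :=
  if is_cplx 1 then
    cmod (whu 1 z0) / cmod (whu 1 (unitv y0))
      * (nuR nu (Th_u 1 t z0) / nuR nu (Th_u 1 t (unitv y0)))
  else cmod (whu 1 z0) / cmod (whu 1 (unitv y0)).
Definition Kinf_m (t : R) (y0 : 'cV[R]_n) : R :=
  if is_cplx 1 then
    1 / cmod (whu 1 (unitv y0))
      * (mnorm nu (Th_m 1 t) / nuR nu (Th_u 1 t (unitv y0)))
  else 1 / cmod (whu 1 (unitv y0)).

End Quantities.

(* Main.v *)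
Require Import Defs.
From HB Require Import structures.
From mathcomp Require Import all_boot all_order all_algebra complex.
From mathcomp Require Import all_classical all_reals all_analysis.
From mathcomp Require Import ring lra.
Set Implicit Arguments. Unset Strict Implicit. Unset Printing Implicit Defensive.
Import Order.TTheory GRing.Theory Num.Theory.
Import numFieldNormedType.Exports.
Local Open Scope ring_scope.

(** All eigenvalues of [A] are simple, so the left and right eigenvectors form
    biorthogonal bases and [expm t A] is the sum over [j] of modes
    [mult_j * e^(r_j t) * f_j *: Th_m j t], with [mult_j = 2] for a conjugate pair
    and [1] for a real eigenvalue. Applied to [u], the mode [j] has norm
    [mult_j * e^(r_j t) * f_j * |hat w_j u| * |Th_u j t u|], so [eps_u t u] and
    [eps_m t] are exactly the sums of the norms of the modes [j >= 2] divided by the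
    norm of the mode [1]. The triangle inequality then compares the norm of
    [expm t A *m u], or of [expm t A], with that of its first mode up to a factor
    [1 + chi], and the theorem is the quotient of two such estimates. *)

(** * Norms and suprema *)

(** [sup] of an unbounded set is [0], so [rnorm] and [mnorm] are meaningful only
    thanks to this comparison of norms, by compactness of the unit sphere. *)
Lemma coord_le_norm (R : realType) (m : nat) (p : 'rV[R]_m -> R) :
  (forall x, p x = 0 -> x = 0) ->
  (forall (c : R) x, p (c *: x) = `|c| * p x) ->
  (forall x y, p (x + y) <= p x + p y) ->
  exists2 c : R, 0 < c & forall (x : 'rV[R]_m) (i : 'I_m), `|x 0 i| <= c * p x.
Proof.
move=> p_eq0 pZ pD.
have p0 : p 0 = 0 by rewrite -(scale0r (0 : 'rV[R]_m)) pZ normr0 mul0r.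
have pN x : p (- x) = p x by rewrite -scaleN1r pZ normrN1 mul1r.
have p_ge0 x : 0 <= p x.
  have := pD x (- x); rewrite subrr p0 pN; lra.
have p_sum (I : finType) (F : I -> 'rV[R]_m) : p (\sum_i F i) <= \sum_i p (F i).
  apply: (big_ind2 (fun x a => p x <= a)) => [|x a y b xa yb|//]; first by rewrite p0.
  by rewrite (le_trans (pD _ _))// lerD.
have coord_le (x : 'rV[R]_m) i : `|x 0 i| <= `|x|.
  rewrite [leRHS]/Num.norm /= mx_normrE; apply/bigmax_geP; right => /=.
  by exists (0, i).
(* Expanding a vector over the standard basis makes [K] a Lipschitz constant of [p] for the max
   norm, whence continuity. *)
pose K := \sum_i p (delta_mx 0 i).
have K_ge0 : 0 <= K by apply: sumr_ge0.
have p_le x : p x <= `|x| * K.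
  rewrite {1}(row_sum_delta x) (le_trans (p_sum _ _))// /K mulr_sumr.
  by apply: ler_sum => i _; rewrite pZ ler_wpM2r.
have p_dist x y : `|p x - p y| <= `|x - y| * K.
  have H a b : p a - p b <= `|a - b| * K.
    rewrite lerBlDr; apply: le_trans (_ : p (a - b) + p b <= _).
      by rewrite -{1}(subrK b a).
    by rewrite lerD2r.
  by rewrite ler_norml H andbT lerNl opprB distrC H.
have p_cont (x : 'rV[R]_m) : {for x, continuous p}.
  apply/(@cvgrPdist_lt _ _ _ _ (nbhs_filter x)) => e e0.
  have K1 : 0 < K + 1 by lra.
  apply/(@nbhs_normP R 'rV[R]_m x); exists (e / (K + 1)) => /=; first by rewrite divr_gt0.
  move=> y /= xy; apply: le_lt_trans (p_dist _ _) _.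
  apply: le_lt_trans (_ : `|x - y| * (K + 1) < _).
    by rewrite ler_wpM2l// lerDl.
  by rewrite -ltr_pdivlMr.
pose S : set 'rV[R]_m := [set x | `|x| = 1]%classic.
have S_compact : compact S.
  apply: bounded_closed_compact.
    by exists 1; split => // M M1 x /= ->; exact: ltW.
  rewrite (_ : S = (@Num.norm _ 'rV[R]_m) @^-1` [set 1])%classic//.
  by apply: closed_comp => [x _|]; [exact: norm_continuous|exact: closed_eq].
have S_unit (x : 'rV[R]_m) : x != 0 -> S (`|x|^-1 *: x).
  by move=> x0; rewrite /S/= normrZ normfV normr_id mulVf ?normr_eq0.
(* If the sphere is empty, every vector is zero and any constant serves. *)
have [[x0 Sx0]|S0] := pselect (S !=set0)%classic; last first.
  exists 1 => // x i; have [->|/S_unit Sx] := eqVneq x 0.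
    by rewrite mxE normr0 mul1r.
  by exfalso; apply: S0; eexists; exact: Sx.
have [||c /set_mem Sc c_min] := @EVT_min_rV R m p S _ S_compact.
- by exists x0.
- exact: continuous_subspaceT.
have pc : 0 < p c.
  rewrite lt_neqAle p_ge0 andbT eq_sym; apply/eqP => /p_eq0 c0.
  by move: Sc; rewrite /S/= c0 normr0 => /eqP; rewrite eq_sym oner_eq0.
(* The constant is the inverse of the minimum of [p] on the sphere; homogeneity carries the bound to
   all nonzero vectors. *)
exists (p c)^-1; first by rewrite invr_gt0.
move=> x i; have [->|nx0] := eqVneq x 0.
  by rewrite mxE normr0 mulr_ge0// invr_ge0.
have := c_min _ (mem_set (S_unit _ nx0)).
rewrite pZ normfV normr_id ler_pdivlMl ?normr_gt0// mulrC => h.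
by rewrite ler_pdivlMl//; apply: le_trans h; rewrite ler_wpM2l.
Qed.

Section Complex_modulus.
Variable R : realType.
Implicit Types (x : R) (z : R[i]).

Lemma cmodE z : cmod z = ComplexField.Normc.normc z.
Proof. by case: z. Qed.

Lemma cmod_ge0 z : 0 <= cmod z.
Proof. exact: sqrtr_ge0. Qed.

Lemma cmodM z1 z2 : cmod (z1 * z2) = cmod z1 * cmod z2.
Proof. by rewrite !cmodE ComplexField.Normc.normcM. Qed.

Lemma cmod_toC x : cmod (toC x) = `|x|.
Proof. by rewrite /cmod /= expr0n addr0 sqrtr_sqr. Qed.

Lemma cmod0 : cmod (0 : R[i]) = 0.
Proof. by rewrite (cmod_toC 0) normr0. Qed.

Lemma cmod_eq0 z : (cmod z == 0) = (z == 0).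
Proof.
apply/eqP/eqP => [|->]; last exact: cmod0.
by rewrite cmodE; exact: ComplexField.Normc.eq0_normc.
Qed.

Lemma cmodD z1 z2 : cmod (z1 + z2) <= cmod z1 + cmod z2.
Proof.
have := ler_normD z1 z2; rewrite !normc_def -rmorphD lecR.
by [].
Qed.

Lemma cmod_sum (I : finType) (F : I -> R[i]) :
  cmod (\sum_i F i) <= \sum_i cmod (F i).
Proof.
apply: (big_ind2 (fun z x => cmod z <= x)) => [|z1 x1 z2 x2 h1 h2|//].
  by rewrite cmod0.
by rewrite (le_trans (cmodD _ _))// lerD.
Qed.

Lemma toC_invM x z : (toC x)^-1 * z = Complex (x^-1 * complex.Re z) (x^-1 * complex.Im z).
Proof.
case: z => a b; rewrite -[toC x]/(real_complex R x) -fmorphV /=.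
by rewrite /real_complex_def; simpc.
Qed.

Lemma toCM x z : toC x * z = Complex (x * complex.Re z) (x * complex.Im z).
Proof. by case: z => a b; rewrite /toC; simpc. Qed.

Lemma ReM z1 z2 : complex.Re (z1 * z2) =
  complex.Re z1 * complex.Re z2 - complex.Im z1 * complex.Im z2.
Proof. by case: z1 z2 => [a b] [c d]. Qed.

Lemma ImM z1 z2 : complex.Im (z1 * z2) =
  complex.Re z1 * complex.Im z2 + complex.Im z1 * complex.Re z2.
Proof. by case: z1 z2 => [a b] [c d]. Qed.

Lemma ReD z1 z2 : complex.Re (z1 + z2) = complex.Re z1 + complex.Re z2.
Proof. by case: z1 z2 => [a b] [c d]. Qed.

Lemma ImD z1 z2 : complex.Im (z1 + z2) = complex.Im z1 + complex.Im z2.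
Proof. by case: z1 z2 => [a b] [c d]. Qed.

Lemma Re_sum (I : Type) (s : seq I) (P : pred I) (F : I -> R[i]) :
  complex.Re (\sum_(i <- s | P i) F i) = \sum_(i <- s | P i) complex.Re (F i).
Proof. exact: (big_morph _ ReD). Qed.

Lemma Im_sum (I : Type) (s : seq I) (P : pred I) (F : I -> R[i]) :
  complex.Im (\sum_(i <- s | P i) F i) = \sum_(i <- s | P i) complex.Im (F i).
Proof. exact: (big_morph _ ImD). Qed.

End Complex_modulus.

Section Sup_image.
Variables (R : realType) (T : Type).
Implicit Types (D : set T) (f g : T -> R).
Local Open Scope classical_set_scope.

Lemma sup_image_le D f b : D !=set0 -> (forall x, D x -> f x <= b) ->
  sup (f @` D) <= b.
Proof.
move=> [x0 Dx0] fb; apply: ge_sup; first by exists (f x0), x0.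
by move=> _ [x Dx <-]; exact: fb.
Qed.

Lemma le_sup_image D f b x : (forall y, D y -> f y <= b) -> D x ->
  f x <= sup (f @` D).
Proof.
move=> fb Dx; apply: ub_le_sup; last by exists x.
by exists b => _ [y Dy <-]; exact: fb.
Qed.

Lemma sup_imageZ D f b c : 0 <= c -> D !=set0 -> (forall x, D x -> f x <= b) ->
  sup ((fun x => c * f x) @` D) = c * sup (f @` D).
Proof.
move=> c0 D0 fb; apply/eqP; rewrite eq_le; apply/andP; split.
  apply: sup_image_le => // x Dx; rewrite ler_wpM2l//.
  exact: le_sup_image fb Dx.
have [->|cn0] := eqVneq c 0.
  have [x0 Dx0] := D0; rewrite mul0r.
  apply: le_trans (@le_sup_image _ _ 0 x0 _ Dx0); first by rewrite mul0r.
  by move=> y _; rewrite mul0r.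
have cp : 0 < c by rewrite lt_neqAle eq_sym cn0.
rewrite -ler_pdivlMl//; apply: sup_image_le => // x Dx.
rewrite ler_pdivlMl//; apply: (@le_sup_image _ (fun x => c * f x) (c * b)) => //.
by move=> y Dy; rewrite ler_wpM2l ?fb.
Qed.

End Sup_image.

(** * Vector norms, induced matrix norms and dual row norms *)

Section Vector_norm.
Variables (R : realType) (n : nat) (nu : 'cV[R[i]]_n -> R).
Hypothesis nu_norm : is_vnorm nu.
Implicit Types (u v : 'cV[R]_n) (z : 'cV[R[i]]_n) (M N : 'M[R]_n).

Let nu_ge0 z : 0 <= nu z. Proof. by case: nu_norm. Qed.
Let nu_eq0 z : nu z = 0 -> z = 0. Proof. by case: nu_norm => _ + _ _; exact. Qed.
Let nuZ c z : nu (c *: z) = cmod c * nu z. Proof. by case: nu_norm. Qed.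
Let nuD z1 z2 : nu (z1 + z2) <= nu z1 + nu z2. Proof. by case: nu_norm. Qed.

Lemma vC_add u v : vC (u + v) = vC u + vC v.
Proof. by apply/matrixP => i j; rewrite !mxE /toC; simpc. Qed.

Lemma vC_scale a u : vC (a *: u) = toC a *: vC u.
Proof. by apply/matrixP => i j; rewrite !mxE /toC; simpc. Qed.

Lemma nuR_ge0 u : 0 <= nuR nu u. Proof. exact: nu_ge0. Qed.

Lemma nuR_eq0 u : nuR nu u = 0 -> u = 0.
Proof.
move=> /nu_eq0 /matrixP u0; apply/matrixP => i j.
by have := u0 i j; rewrite !mxE => -[].
Qed.

Lemma nuRZ a u : nuR nu (a *: u) = `|a| * nuR nu u.
Proof. by rewrite /nuR vC_scale nuZ cmod_toC. Qed.

Lemma nuRD u v : nuR nu (u + v) <= nuR nu u + nuR nu v.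
Proof. by rewrite /nuR vC_add. Qed.

Lemma nuR0 : nuR nu 0 = 0.
Proof. by rewrite -(scale0r 0) nuRZ normr0 mul0r. Qed.

Lemma nuR_gt0 u : u != 0 -> 0 < nuR nu u.
Proof.
move=> u0; rewrite lt_neqAle nuR_ge0 andbT eq_sym.
by apply: contra u0 => /eqP/nuR_eq0 ->.
Qed.

Lemma nuR_unitv u : u != 0 -> nuR nu (unitv nu u) = 1.
Proof.
move=> /nuR_gt0 u0; rewrite /unitv nuRZ normfV ger0_norm ?nuR_ge0//.
by rewrite mulVf// gt_eqF.
Qed.

(** Reading C^n as R^(2n) through real and imaginary parts reduces this to [coord_le_norm]; each
    part costs one [c], hence the constant [c + c]. *)
Lemma cmod_coord_le : exists2 c : R, 0 < c &
  forall z k, cmod (z k 0) <= c * nu z.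
Proof.
pose f (x : 'rV[R]_(n + n)) : 'cV[R[i]]_n :=
  \col_k Complex (x 0 (lshift n k)) (x 0 (rshift n k)).
have [||| c c0 hc] := @coord_le_norm R (n + n) (nu \o f).
- move=> x /= /nu_eq0 /matrixP fx0; apply/rowP => i; rewrite mxE.
  by case: (split_ordP i) => k ->; have := fx0 k 0; rewrite !mxE => -[].
- move=> c x /=; rewrite (_ : f (c *: x) = toC c *: f x) ?nuZ ?cmod_toC//.
  by apply/matrixP => i j; rewrite !mxE /toC; simpc.
- move=> x y /=; rewrite (_ : f (x + y) = f x + f y)//.
  by apply/matrixP => i j; rewrite !mxE; simpc.
exists (c + c); first by rewrite addr_gt0.
move=> z k.
pose x : 'rV[R]_(n + n) :=
  row_mx (\row_l complex.Re (z l 0)) (\row_l complex.Im (z l 0)).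
have fx : f x = z.
  apply/matrixP => i j; rewrite ord1 mxE row_mxEl row_mxEr 2!mxE.
  by case: (z i 0).
have /= := hc x (lshift n k); have /= := hc x (rshift n k).
rewrite fx row_mxEl row_mxEr !mxE => hI hR.
case: (z k 0) hI hR => a b /= hI hR.
rewrite (_ : Complex a b = toC a + toC b * Complex 0 1); last by rewrite /toC; simpc.
apply: le_trans (cmodD _ _) _; rewrite cmodM !cmod_toC.
rewrite [cmod (Complex 0 1)]/cmod /= expr0n expr1n add0r sqrtr1 mulr1 mulrDl.
exact: lerD.
Qed.

(** Keeps the sets in [rnorm] bounded above, so that their suprema are genuine. *)
Lemma rdot_bounded (w : 'rV[R[i]]_n) : exists2 b : R, 0 <= b &
  forall z, cmod (rdot w z) <= b * nu z.
Proof.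
have [c c0 hc] := cmod_coord_le.
exists (\sum_k cmod (w 0 k) * c).
  by apply: sumr_ge0 => k _; rewrite mulr_ge0 ?cmod_ge0 ?ltW.
move=> z; rewrite /rdot mxE (le_trans (cmod_sum _))// mulr_suml.
by apply: ler_sum => k _; rewrite cmodM -mulrA ler_wpM2l ?cmod_ge0.
Qed.

(** Serves [mnorm] as [rdot_bounded] serves [rnorm]; the constant comes from writing [M *m u] as a
    combination of the columns of [M]. *)
Lemma nuR_mulmx_bounded M : exists2 b : R, 0 <= b &
  forall u, nuR nu (M *m u) <= b * nuR nu u.
Proof.
have [c c0 hc] := cmod_coord_le.
have nu_sum (F : 'I_n -> 'cV[R]_n) : nuR nu (\sum_i F i) <= \sum_i nuR nu (F i).
  apply: (big_ind2 (fun (z : 'cV[R]_n) (x : R) => nuR nu z <= x)) => [|z1 x1 z2 x2 h1 h2|//].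
    by rewrite nuR0.
  by rewrite (le_trans (nuRD _ _))// lerD.
exists (\sum_k c * nuR nu (col k M)).
  by apply: sumr_ge0 => k _; rewrite mulr_ge0 ?nuR_ge0 ?ltW.
move=> u; have -> : M *m u = \sum_k u k 0 *: col k M.
  apply/matrixP => i j; rewrite !mxE summxE ord1; apply: eq_bigr => k _.
  by rewrite !mxE mulrC.
apply: le_trans (nu_sum _) _; rewrite mulr_suml; apply: ler_sum => k _.
rewrite nuRZ mulrAC ler_wpM2r ?nuR_ge0//.
by have := hc (vC u) k; rewrite mxE cmod_toC.
Qed.

Lemma nuR_mulmx_le M u : nuR nu (M *m u) <= mnorm nu M * nuR nu u.
Proof.
have [->|u0] := eqVneq u 0; first by rewrite mulmx0 nuR0 mulr0.
have un := nuR_gt0 u0; rewrite -ler_pdivrMr//.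
have [b b0 hb] := nuR_mulmx_bounded M.
apply: le_trans (@le_sup_image R _ _ _ b (unitv nu u) _ _).
- by rewrite /unitv -scalemxAr nuRZ normfV ger0_norm ?nuR_ge0// mulrC.
- by move=> y /= y1; rewrite (le_trans (hb _))// y1 mulr1.
- exact: nuR_unitv.
Qed.

Section Matrix_norm.
(** A witness that the real unit sphere is nonempty, which excludes dimension 0. *)
Variable u0 : 'cV[R]_n.
Hypothesis u0_unit : nuR nu u0 = 1.

Let S0 : ([set u | nuR nu u = 1] !=set0)%classic.
Proof. by exists u0. Qed.

Lemma mnorm_ge0 M : 0 <= mnorm nu M.
Proof.
have := nuR_mulmx_le M u0; rewrite u0_unit mulr1; apply: le_trans; exact: nuR_ge0.
Qed.

Lemma mnormD M N : mnorm nu (M + N) <= mnorm nu M + mnorm nu N.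
Proof.
apply: sup_image_le => // u /= u1; rewrite mulmxDl (le_trans (nuRD _ _))// lerD//.
  by have := nuR_mulmx_le M u; rewrite u1 mulr1.
by have := nuR_mulmx_le N u; rewrite u1 mulr1.
Qed.

Lemma mnormZ a M : mnorm nu (a *: M) = `|a| * mnorm nu M.
Proof.
have [b b0 hb] := nuR_mulmx_bounded M.
rewrite /mnorm -(@sup_imageZ _ _ _ _ b)//; last first.
  by move=> x /= x1; rewrite (le_trans (hb _))// x1 mulr1.
by congr sup; apply: eq_imagel => u _; rewrite -scalemxAl nuRZ.
Qed.

Lemma mnorm_gt0 M u : M *m u != 0 -> 0 < mnorm nu M.
Proof.
move=> Mu; rewrite lt_neqAle mnorm_ge0 andbT eq_sym.
apply: contra Mu => /eqP M0; apply/eqP/nuR_eq0/le_anti.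
by rewrite nuR_ge0 andbT (le_trans (nuR_mulmx_le M u))// M0 mul0r.
Qed.

End Matrix_norm.

(** A nonzero entry of [w] is detected by a normalized basis vector; being real, this vector lies on
    both spheres over which [rnorm] may take its supremum. *)
Lemma rnorm_gt0 (w : 'rV[R[i]]_n) : w != 0 -> 0 < rnorm nu w.
Proof.
move=> w0; have [b b0 hb] := rdot_bounded w.
have [k wk] : exists k, w 0 k != 0.
  apply/existsP; rewrite -negb_forall; apply: contra w0 => /forallP w0.
  by apply/eqP/rowP => k; rewrite mxE; exact/eqP.
pose e : 'cV[R]_n := delta_mx k 0.
have e0 : e != 0.
  by apply/eqP => /matrixP/(_ k 0); rewrite !mxE !eqxx => /eqP; rewrite oner_eq0.
have e1 := nuR_unitv e0.
have we : 0 < cmod (rdot w (vC (unitv nu e))).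
  rewrite lt_neqAle cmod_ge0 andbT eq_sym cmod_eq0 /rdot /unitv vC_scale -scalemxAr mxE.
  rewrite mulf_eq0 negb_or; apply/andP; split.
    by rewrite -cmod_eq0 cmod_toC normr_eq0 invr_eq0 gt_eqF ?nuR_gt0.
  rewrite mxE (bigD1 k)//= big1 => [|i ik]; rewrite !mxE ?eqxx.
    by rewrite addr0 (_ : toC 1 = 1)// mulr1.
  by rewrite (negbTE ik) (_ : toC 0 = 0)// mulr0.
rewrite /rnorm; case: ifP => _; apply: lt_le_trans we _.
  apply: (@le_sup_image R _ _ (fun u => cmod (rdot w (vC u))) b (unitv nu e)) => // u /= u1.
  by rewrite (le_trans (hb _))// [nu _]u1 mulr1.
have := @le_sup_image R _ [set z | nu z = 1]%classic (fun z => cmod (rdot w z)) b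
  (vC (unitv nu e)).
apply=> // z /= z1.
by rewrite (le_trans (hb _))// z1 mulr1.
Qed.

End Vector_norm.

(** * The exponential series *)

Section Exponential_series.
Variables (R : realType) (lam : R[i]).
Implicit Types (c : R[i]) (t x : R).
Local Open Scope classical_set_scope.
Local Open Scope ring_scope.

(** Taylor coefficients at 0 of the function Re(e^(lam t) c) of the real variable t. *)
Let a c (k : nat) : R := complex.Re (lam ^+ k * c) / k`!%:R.

Lemma Re_le_cmod c : `|complex.Re c| <= cmod c.
Proof. by have := normc_ge_Re c; rewrite normc_def lecR. Qed.

Lemma cmodX c k : cmod (c ^+ k) = cmod c ^+ k.
Proof.
elim: k => [|k IH]; first by rewrite !expr0 (cmod_toC (1 : R)) normr1.
by rewrite !exprS cmodM IH.
Qed.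

(** Absolute convergence, by domination with |c| times the series of e^(|lam| |t|). *)
Let a_cvg c t : cvgn (pseries (a c) t).
Proof.
apply: normed_cvg; rewrite /normed_series_of /=.
apply: (@series_le_cvg _ _ (fun k => cmod c * exp_coeff (cmod lam * `|t|) k)).
- by move=> k; exact: normr_ge0.
- move=> k; rewrite mulr_ge0 ?cmod_ge0// /exp_coeff/= divr_ge0// exprn_ge0//.
  by rewrite mulr_ge0 ?cmod_ge0.
- move=> k; rewrite /a /exp_coeff /= !normrM normfV (ger0_norm (ler0n _ _)) normrX exprMn.
  rewrite mulrAC [leRHS]mulrA ler_wpM2r ?invr_ge0 ?ler0n// [leRHS]mulrA ler_wpM2r ?exprn_ge0//.
  by rewrite (le_trans (Re_le_cmod _))// cmodM cmodX mulrC.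
- by apply: is_cvg_seriesZ; exact: is_cvg_series_exp_coeff.
Qed.

(** The factor k+1 from differentiation cancels against (k+1)!, leaving one extra power of [lam],
    which is absorbed into [c]. *)
Let a_diffs c : pseries_diffs (a c) = a (lam * c).
Proof.
apply/funext => k; rewrite /pseries_diffs /a factS natrM invfM exprSr -mulrA.
have k0 : k.+1%:R != 0 :> R by rewrite pnatr_eq0.
have f0 : k`!%:R != 0 :> R by rewrite pnatr_eq0 -lt0n fact_gt0.
by field; rewrite nat1r f0 k0.
Qed.

Let F c t : R := limn (pseries (a c) t).

Let F_derive c t : is_derive t (1 : R) (F c) (F (lam * c) t).
Proof.
rewrite /F -a_diffs; apply: (@pseries_snd_diffs _ _ (`|t| + 1)).
- exact: a_cvg.
- by rewrite a_diffs; exact: a_cvg.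
- by rewrite !a_diffs; exact: a_cvg.
- by rewrite [ltRHS]ger0_norm// ltrDl.
Qed.

(** Taking real parts leaves only real linearity, which is why [c] and its multiple by the imaginary
    unit are tracked together below. *)
Let F_lin c1 c2 (x1 x2 : R) t :
  F (toC x1 * c1 + toC x2 * c2) t = x1 * F c1 t + x2 * F c2 t.
Proof.
apply: cvg_lim => //.
rewrite (_ : pseries _ t = (fun N => x1 * pseries (a c1) t N + x2 * pseries (a c2) t N)).
  by apply: cvgD; apply: cvgMr; exact: a_cvg.
apply/funext => N; rewrite /pseries /series /= !mulr_sumr -big_split /=.
apply: eq_bigr => k _; rewrite /a mulrDr ReD !(mulrCA (lam ^+ k)) !toCM /=.
by ring.
Qed.

Let F0 c : F c 0 = complex.Re c.
Proof.
(* The partial sum of index 0 is empty; the value is attained from index 1 on. *)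
apply: lim_near_cst => //; near=> m; rewrite -[m]prednK; last by near: m.
rewrite /pseries /series /= big_nat_recl //= big1 ?addr0.
  by rewrite /a expr0 mul1r fact0 divr1 expr0 mulr1.
by move=> i _; rewrite expr0n mulr0.
Unshelve. all: by end_near. Qed.

(** With [F c] the sum of the series, [F c]' = [F (lam * c)], a linear system in
    [F c] and [F ('i * c)]; the functions [H1] and [H2] below are its first
    integrals. *)
Lemma exp_series_cvg c t :
  (fun N : nat => \sum_(k < N) t ^+ k / k`!%:R * complex.Re (lam ^+ k * c))
    @ \oo --> expR (complex.Re lam * t) * complex.Re (cexpi (complex.Im lam * t) * c).
Proof.
rewrite (_ : (fun _ => _) = pseries (a c) t); last first.
  apply/funext => N; rewrite /pseries /series /= big_mkord; apply: eq_bigr => k _.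
  by rewrite /a; ring.
suff <- : F c t = expR (complex.Re lam * t) * complex.Re (cexpi (complex.Im lam * t) * c).
  exact: a_cvg.
set r := complex.Re lam; set om := complex.Im lam.
pose ic : R[i] := Complex 0 1 * c.
have lamE : lam = toC r + toC om * Complex 0 1.
  by rewrite /r /om /toC; case: (lam) => x y; simpc.
have iic : Complex 0 1 * ic = - c.
  by rewrite mulrA -[Complex 0 1 * _]expr2 sqr_i mulN1r.
have omN : toC (- om) = - toC om by rewrite /toC -[RHS]/(Complex (- om) (- 0)) oppr0.
have lamc : lam * c = toC r * c + toC om * ic by rewrite lamE mulrDl -mulrA.
have lamic : lam * ic = toC (- om) * c + toC r * ic.
  by rewrite omN lamE mulrDl -[X in _ + X]mulrA iic mulrN mulNr addrC.
have FE x : F (lam * c) x = r * F c x + om * F ic x by rewrite lamc F_lin.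
have GE x : F (lam * ic) x = - om * F c x + r * F ic x by rewrite lamic F_lin.
have dF x := F_derive c x; have dG x := F_derive ic x.
(* [H1 - i H2] is e^(-lam x) times [F c - i F ic], where the latter stands for e^(lam x) c; its
   constant value is therefore [c]. *)
pose H1 x := expR (- r * x) * (F c x * cos (om * x) - F ic x * sin (om * x)).
pose H2 x := expR (- r * x) * (F c x * sin (om * x) + F ic x * cos (om * x)).
have h1 : H1 t = complex.Re c.
  transitivity (H1 0); last first.
    by rewrite /H1 !mulr0 expR0 cos0 sin0 !F0; ring.
  apply: is_derive_0_is_cst => x; rewrite /H1.
  apply: trigger_derive; rewrite /GRing.scale /= FE GE; ring.
have h2 : H2 t = - complex.Im c.
  transitivity (H2 0); last first.
    rewrite /H2 !mulr0 expR0 cos0 sin0 !F0 /ic ReM /=; ring.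
  apply: is_derive_0_is_cst => x; rewrite /H2.
  apply: trigger_derive; rewrite /GRing.scale /= FE GE; ring.
have e1 : expR (r * t) * expR (- r * t) = 1.
  by rewrite -expRD mulNr subrr expR0.
have cs := cos2Dsin2 (om * t).
rewrite ReM /= -h1 -[complex.Im c]opprK -h2 /H1 /H2.
set C := cos _ in cs *; set S := sin _ in cs *.
(* Rotating the pair [H1], [H2] back by the angle [om * t] eliminates [F ic]. *)
transitivity (F c t * (expR (r * t) * expR (- r * t)) * (C ^+ 2 + S ^+ 2)).
  by rewrite e1 cs !mulr1.
ring.
Qed.

End Exponential_series.

(** * Spectral decomposition *)

(** Biorthogonality says [Wm *m Vm = 1]; for square matrices then [Vm *m Wm = 1],
    which is the resolution of the identity. *)
Lemma exp_mx_eigenbasis (F : fieldType) (n : nat) (B : 'M[F]_n) (mu : 'I_n -> F)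
    (V : 'I_n -> 'cV[F]_n) (W : 'I_n -> 'rV[F]_n) (k : nat) :
  injective mu ->
  (forall i, B *m V i = mu i *: V i) -> (forall i, W i *m B = mu i *: W i) ->
  (forall i, (W i *m V i) 0 0 = 1) ->
  B ^+ k = \sum_i mu i ^+ k *: (V i *m W i).
Proof.
move=> mu_inj BV WB WV.
pose Vm : 'M[F]_n := \matrix_(a, i) V i a 0.
pose Wm : 'M[F]_n := \matrix_(i, a) W i 0 a.
have WVE i j : (Wm *m Vm) i j = (W i *m V j) 0 0.
  by rewrite !mxE; apply: eq_bigr => a _; rewrite !mxE.
have WV1 : Wm *m Vm = 1%:M.
  apply/matrixP => i j; rewrite WVE [RHS]mxE; have [->|ij] := eqVneq i j; first by rewrite WV.
  (* Evaluating [W i *m B *m V j] in two ways shows that eigenvectors for distinct eigenvalues are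
     orthogonal. *)
  have : mu i *: (W i *m V j) = mu j *: (W i *m V j).
    by rewrite scalemxAl -WB -mulmxA BV scalemxAr.
  move/eqP; rewrite -subr_eq0 -scalerBl scaler_eq0 subr_eq0 => /orP[/eqP/mu_inj e|/eqP ->].
    by rewrite e eqxx in ij.
  by rewrite mxE.
have VW : 1%:M = \sum_i V i *m W i.
  rewrite -(mulmx1C WV1); apply/matrixP => a b; rewrite summxE !mxE.
  by apply: eq_bigr => i _; rewrite !mxE big_ord1.
elim: k => [|k IH].
  by rewrite expr0 -[1]/(1%:M) VW; apply: eq_bigr => i _; rewrite expr0 scale1r.
rewrite exprS IH mulr_sumr; apply: eq_bigr => i _.
by rewrite -[B * _]/(B *m _) -scalemxAr mulmxA BV -scalemxAl scalerA exprSr.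
Qed.

Lemma mC_exp (R : realType) (n : nat) (A : 'M[R]_n) k : mC (A ^+ k) = mC A ^+ k.
Proof.
elim: k => [|k IH]; first by rewrite !expr0 -[LHS]/(map_mx (real_complex R) 1%:M) map_mx1.
rewrite !exprS -IH; exact: (@map_mxM _ _ (real_complex R)).
Qed.

Section Spectral_decomposition.
Variables (R : realType) (n : nat) (A : 'M[R]_n) (q : nat) (r : nat -> R)
  (lam : nat -> R[i]) (w : nat -> 'rV[R[i]]_n) (v : nat -> 'cV[R[i]]_n).
Hypothesis r_decr : forall j, (1 <= j < q)%N -> r j.+1 < r j.
Hypothesis eig_r : forall mu : R[i], eigenvalue (mC A) mu ->
     exists j, (1 <= j <= q)%N /\ complex.Re mu = r j.
Hypothesis eig_lam : forall j, (1 <= j <= q)%N ->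
     Lambda_real A (r j) (lam j) \/ Lambda_complex A (r j) (lam j).
Hypothesis wA : forall j, (1 <= j <= q)%N -> w j *m mC A = lam j *: w j.
Hypothesis Av : forall j, (1 <= j <= q)%N -> mC A *m v j = lam j *: v j.
Hypothesis wv : forall j, (1 <= j <= q)%N -> rdot (w j) (v j) = 1.

Lemma decreasing_lt i j : (1 <= i)%N -> (i < j)%N -> (j <= q)%N -> r j < r i.
Proof.
move=> i1; elim: j => // j IH; rewrite ltnS leq_eqVlt => /orP[/eqP <- jq|ij jq].
  by apply: r_decr; rewrite i1.
apply: lt_trans (IH ij (ltnW jq)); apply: r_decr.
by rewrite (leq_trans i1 (ltnW ij)).
Qed.

Let r_inj i j : (1 <= i <= q)%N -> (1 <= j <= q)%N -> r i = r j -> i = j.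
Proof.
move=> /andP[i1 iq] /andP[j1 jq] e; case: (ltngtP i j) => // ij.
  by have := decreasing_lt i1 ij jq; rewrite e ltxx.
by have := decreasing_lt j1 ij iq; rewrite e ltxx.
Qed.

(** The number of eigenvalues with real part [r j]; since each is simple, this is not an algebraic
    multiplicity. *)
Definition multiplicity j : R := if is_cplx lam j then 2 else 1.

Let conjM m p (M : 'M[R[i]]_(m, p)) : 'M[R[i]]_(m, p) := map_mx (@conjc R) M.

Let conj_mC : conjM (mC A) = mC A.
Proof. by apply/matrixP => a b; rewrite !mxE /toC /= oppr0. Qed.

(** The characteristic polynomial splits over C with simple roots, so [exp_mx_eigenbasis] applies.
    As [A] is real, conjugating [v j] and [w j] gives eigenvectors for the conjugate eigenvalue, and
    the two conjugate terms share their real part. *)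
Lemma spectral_exp k : A ^+ k = \sum_(1 <= j < q.+1)
  multiplicity j *: \matrix_(a, b) complex.Re (lam j ^+ k * (v j a 0 * w j 0 b)).
Proof.
have [rs rsE] := closed_field_poly_normal (char_poly (mC A)).
rewrite (monicP (char_poly_monic _)) scale1r in rsE.
have rs_eig z : (z \in rs) = eigenvalue (mC A) z.
  by rewrite eigenvalue_root_char rsE root_prod_XsubC.
have rs_size : size rs = n.
  by have := size_char_poly (mC A); rewrite rsE size_prod_XsubC => -[].
(* [jof] sends a root to the index of its real part; outside [rs] its value is arbitrary. *)
have /choice[jof jofP] (z : R[i]) : exists j,
    z \in rs -> (1 <= j <= q)%N /\ complex.Re z = r j.
  have [zrs|_] := boolP (z \in rs); last by exists 0%N.
  by have [j jP] := eig_r (eq_ind _ is_true zrs _ (rs_eig z)); exists j.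
have cconjE z : cconj z = conjc z by case: z.
have rs_case z : z \in rs -> let j := jof z in
    z = lam j /\ 0 <= complex.Im z \/ z = conjc (lam j) /\ complex.Im z < 0.
  move=> zrs j; have [jq zr] := jofP z zrs.
  case: (eig_lam jq) => [[im0 _ H]|[im0 _ _ H]].
    left; have <- : z = lam j by apply/H; rewrite -rs_eig.
    split=> //; suff -> : z = lam j by rewrite im0.
    by apply/H; rewrite -rs_eig.
  have [->|->] : z = lam j \/ z = cconj (lam j) by apply/H; rewrite -rs_eig.
    by left; split => //; exact: ltW.
  by right; rewrite cconjE; split=> //; rewrite -cconjE /= oppr_lt0.
(* The number of occurrences in [rs] is the multiplicity as a root, which the hypotheses on each
   class fix to 1. *)
have rs_uniq : uniq rs.
  apply: count_mem_uniq => z; rewrite -mu_prod_XsubC -rsE.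
  have [zrs|zrs] := boolP (z \in rs); last first.
    by rewrite mupNroot// -eigenvalue_root_char -rs_eig.
  have [jq zr] := jofP z zrs.
  case: (eig_lam jq) => [[_ m1 H]|[_ m1 m2 H]].
    have -> : z = lam (jof z) by apply/H; rewrite -rs_eig.
    exact: m1.
  have [->|->] : z = lam (jof z) \/ z = cconj (lam (jof z)) by apply/H; rewrite -rs_eig.
    exact: m1.
  exact: m2.
(* Every [lam j] has nonnegative imaginary part, so the sign of Im z tells [lam j] from its
   conjugate. *)
pose V z := if 0 <= complex.Im z then v (jof z) else conjM (v (jof z)).
pose W z := if 0 <= complex.Im z then w (jof z) else conjM (w (jof z)).
have VW_case z (zrs : z \in rs) (j := jof z) :
    [/\ z = lam j, V z = v j & W z = w j] \/
    [/\ z = conjc (lam j), V z = conjM (v j) & W z = conjM (w j)].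
  rewrite /V /W; have [[zE im0]|[zE im0]] := rs_case z zrs; [left|right].
    by rewrite im0.
  by rewrite leNgt im0.
have AV z : z \in rs -> mC A *m V z = z *: V z.
  move=> zrs; have [jq _] := jofP z zrs.
  have [[zE -> _]|[zE -> _]] := VW_case z zrs; rewrite [X in _ = X *: _]zE.
    by rewrite Av.
  rewrite -conj_mC -map_mxM Av//.
  by apply/matrixP => a b; rewrite !mxE rmorphM.
have WA z : z \in rs -> W z *m mC A = z *: W z.
  move=> zrs; have [jq _] := jofP z zrs.
  have [[zE _ ->]|[zE _ ->]] := VW_case z zrs; rewrite [X in _ = X *: _]zE.
    by rewrite wA.
  rewrite -conj_mC -map_mxM wA//.
  by apply/matrixP => a b; rewrite !mxE rmorphM.
have WV z : z \in rs -> (W z *m V z) 0 0 = 1.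
  move=> zrs; have [jq _] := jofP z zrs.
  have [[_ -> ->]|[_ -> ->]] := VW_case z zrs; first exact: wv.
  by have := wv jq; rewrite -map_mxM [X in _ -> X = _]mxE /rdot => ->; rewrite rmorph1.
pose mu (i : 'I_n) := rs`_i.
have mu_rs i : mu i \in rs by rewrite mem_nth// rs_size.
have mu_inj : injective mu.
  by move=> i i' /eqP; rewrite nth_uniq ?rs_size// => /eqP/val_inj.
have powE := exp_mx_eigenbasis k mu_inj (fun i => AV _ (mu_rs i))
  (fun i => WA _ (mu_rs i)) (fun i => WV _ (mu_rs i)).
apply/matrixP => a b; rewrite summxE.
pose g (z : R[i]) := complex.Re (z ^+ k * (V z a 0 * W z 0 b)).
have -> : (A ^+ k) a b = \sum_(z <- rs) g z.
  rewrite -[LHS]/(complex.Re (toC ((A ^+ k) a b))).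
  rewrite (_ : toC ((A ^+ k) a b) = mC (A ^+ k) a b); last by rewrite mxE.
  rewrite mC_exp powE summxE Re_sum (big_nth 0) rs_size big_mkord.
  by apply: eq_bigr => i _; rewrite /g !mxE big_ord1.
(* Roots are grouped by real part; each falls into exactly one group because [r] is injective on the
   indices. *)
have -> : \sum_(z <- rs) g z =
    \sum_(1 <= j < q.+1) \sum_(z <- rs | complex.Re z == r j) g z.
  rewrite (exchange_big_dep xpredT)//= [LHS]big_seq [RHS]big_seq.
  apply: eq_bigr => z zrs; have [jq zr] := jofP z zrs.
  rewrite big_mkcond (bigD1_seq (jof z)) ?iota_uniq ?mem_index_iota//= {1}zr eqxx.
  rewrite big_seq_cond big1 ?addr0// => j /andP[].
  rewrite mem_index_iota ltnS => jq' jz; case: eqP => // zr'.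
  by move/eqP: jz; case; apply: r_inj => //; rewrite -zr -zr'.
apply: eq_big_nat => j; rewrite ltnS => jq.
have gE z : z \in [seq z <- rs | complex.Re z == r j] ->
    g z = complex.Re (lam j ^+ k * (v j a 0 * w j 0 b)).
  rewrite mem_filter => /andP[/eqP zr zrs]; have [jq' zr'] := jofP z zrs.
  have jE : jof z = j by apply: r_inj => //; rewrite -zr -zr'.
  rewrite /g; have [[zE -> ->]|[zE -> ->]] := VW_case z zrs; rewrite [X in X ^+ k]zE jE//.
  by rewrite !mxE -rmorphM -rmorphXn -rmorphM; case: (_ * _).
have sumE s : perm_eq [seq z <- rs | complex.Re z == r j] s ->
    \sum_(z <- rs | complex.Re z == r j) g z =
    complex.Re (lam j ^+ k * (v j a 0 * w j 0 b)) *+ size s.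
  move=> /perm_size <-; rewrite -big_filter big_seq (eq_bigr _ gE) -big_seq.
  by rewrite big_const_seq count_predT iter_addr_0.
have filterE z : (z \in [seq z <- rs | complex.Re z == r j]) <->
    eigenvalue (mC A) z /\ complex.Re z = r j.
  rewrite mem_filter rs_eig; split=> [/andP[/eqP]//|[-> ->]]; by rewrite eqxx.
rewrite mxE mxE /multiplicity /is_cplx.
case: (eig_lam jq) => [[im0 _ H]|[im0 _ _ H]].
  rewrite im0 ltxx mul1r (sumE [:: lam j])//.
  apply: uniq_perm; rewrite ?filter_uniq// => z; rewrite inE.
  by apply/idP/eqP => [/filterE/H|/H/filterE].
(* The two listed roots differ since Im(lam j) > 0, so the common term is counted twice. *)
rewrite im0 (sumE [:: lam j; cconj (lam j)]) ?mulr_natl//.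
apply: uniq_perm; rewrite ?filter_uniq//=.
  rewrite inE andbT; apply/eqP => e; have : complex.Im (lam j) = - complex.Im (lam j).
    by rewrite {1}e.
  by lra.
move=> z; rewrite !inE; apply/idP/orP => [/filterE/H[]->|zE]; rewrite ?eqxx; auto.
by apply/filterE/H; case: zE => /eqP; auto.
Qed.

End Spectral_decomposition.

(** * Modes of the exponential *)

(** [chi] is the relative error of keeping [x] alone, bounded by the triangle inequality used in
    both directions. The abstract [p] covers both [nuR nu] and [mnorm nu]. *)
Lemma seminorm_perturbation (R : realType) (V : lmodType R) (p : V -> R)
    (s : seq nat) (x : V) (y : nat -> V) :
  (forall a z, p (a *: z) = `|a| * p z) -> (forall z1 z2, p (z1 + z2) <= p z1 + p z2) ->
  0 < p x ->
  exists chi : R, p (x + \sum_(j <- s) y j) = p x * (1 + chi) /\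
    `|chi| <= \sum_(j <- s) p (y j) / p x.
Proof.
move=> pZ pD px.
have p0 : p 0 = 0 by rewrite -(scale0r 0) pZ normr0 mul0r.
have p_sum : p (\sum_(j <- s) y j) <= \sum_(j <- s) p (y j).
  apply: (big_ind2 (fun (z : V) (a : R) => p z <= a)) => [|z1 a1 z2 a2 h1 h2|//].
    by rewrite p0.
  by rewrite (le_trans (pD _ _))// lerD.
set z := \sum_(j <- s) y j in p_sum *.
exists (p (x + z) / p x - 1); split; first by field; rewrite gt_eqF.
have -> : p (x + z) / p x - 1 = (p (x + z) - p x) / p x by field; rewrite gt_eqF.
rewrite -mulr_suml normrM normfV (gtr0_norm px) ler_pM2r ?invr_gt0//.
apply: le_trans p_sum; rewrite ler_norml; apply/andP; split.
  have := pD (x + z) (- z); rewrite addrK -scaleN1r pZ normrN1 mul1r; lra.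
have := pD x z; lra.
Qed.

(** The common scale [a] cancels, and (1 + chi1)/(1 + chi2) differs from 1 by (chi1 - chi2)/(1 +
    chi2), whose denominator is at least 1 - e2 > 0. *)
Lemma approx_prec_ratio (R : realType) (a x y chi1 chi2 e1 e2 : R) :
  0 < a -> 0 < y -> `|chi1| <= e1 -> `|chi2| <= e2 -> e2 < 1 ->
  approx_prec (a * x * (1 + chi1) / (a * y * (1 + chi2))) (x / y) ((e1 + e2) / (1 - e2)).
Proof.
move=> a0 y0 h1 h2 e21.
have h : 0 < 1 - e2 by rewrite subr_gt0.
have h' : 1 - e2 <= 1 + chi2.
  have : - chi2 <= `|chi2| by rewrite -normrN ler_norm.
  lra.
have c0 : 0 < 1 + chi2 by exact: lt_le_trans h'.
exists ((chi1 - chi2) / (1 + chi2)); split.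
  by field; rewrite !gt_eqF.
rewrite normrM normfV (gtr0_norm c0); apply: ler_pM => //.
- by rewrite invr_ge0 ltW.
- by rewrite (le_trans (ler_normB _ _))// lerD.
- by rewrite lef_pV2 ?posrE.
Qed.

Lemma cexpiM (R : realType) (a b : R) : cexpi a * cexpi b = cexpi (a + b).
Proof. by rewrite /cexpi cosD sinD; simpc; congr Complex; ring. Qed.

Lemma cmod_cexpi (R : realType) (a : R) : cmod (cexpi a) = 1.
Proof. by rewrite /cmod /= cos2Dsin2 sqrtr1. Qed.

Lemma vCE (R : realType) (n : nat) (u : 'cV[R]_n) k : vC u k 0 = toC (u k 0).
Proof. by rewrite mxE. Qed.

(** Unifies the four cases of G_j: each is the correction that makes the summand a quotient of mode
    norms, the factors 2 being the weights of conjugate pairs. *)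
Lemma G_term (R : realType) (bj b1 : bool) (Ej E1 fj f1 cj c1 nj n1 : R) :
  E1 != 0 -> f1 != 0 -> c1 != 0 -> (b1 -> n1 != 0) ->
  Ej * E1^-1 * (fj / f1) * (cj / c1) *
    match bj, b1 with
    | false, false => 1
    | true, false => 2 * nj
    | false, true => 1 / (2 * n1)
    | true, true => nj / n1
    end =
  (if bj then 2 else 1) * (Ej * fj) * (if bj then cj * nj else cj) /
    ((if b1 then 2 else 1) * (E1 * f1) * (if b1 then c1 * n1 else c1)).
Proof.
move=> E10 f10 c10; case: bj; case: b1 => n10.
- by field; rewrite E10 f10 c10 n10.
- by field; rewrite E10 f10 c10.
- by field; rewrite E10 f10 c10 n10.
- by field; rewrite E10 f10 c10.
Qed.

Section Expansion.
Variables (R : realType) (n : nat) (nu : 'cV[R[i]]_n -> R) (A : 'M[R]_n) (q : nat)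
  (r : nat -> R) (lam : nat -> R[i]) (w : nat -> 'rV[R[i]]_n) (v : nat -> 'cV[R[i]]_n)
  (alpha beta : nat -> 'I_n -> R) (gamma : nat -> 'cV[R]_n -> R).
Hypothesis nu_norm : is_vnorm nu.
Hypothesis r_decr : forall j, (1 <= j < q)%N -> r j.+1 < r j.
Hypothesis eig_r : forall mu : R[i], eigenvalue (mC A) mu ->
     exists j, (1 <= j <= q)%N /\ complex.Re mu = r j.
Hypothesis eig_lam : forall j, (1 <= j <= q)%N ->
     Lambda_real A (r j) (lam j) \/ Lambda_complex A (r j) (lam j).
Hypothesis wA : forall j, (1 <= j <= q)%N -> w j *m mC A = lam j *: w j.
Hypothesis Av : forall j, (1 <= j <= q)%N -> mC A *m v j = lam j *: v j.
Hypothesis wv : forall j, (1 <= j <= q)%N -> rdot (w j) (v j) = 1.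
Hypothesis real_wv : forall j, (1 <= j <= q)%N -> complex.Im (lam j) = 0 ->
     is_real_row (w j) /\ (forall k, complex.Im (v j k 0) = 0).
Hypothesis polar_v : forall j k, (1 <= j <= q)%N ->
     hatv nu (v j) k 0 = toC (cmod (hatv nu (v j) k 0)) * cexpi (alpha j k).
Hypothesis polar_w : forall j l, (1 <= j <= q)%N ->
     hatw nu (w j) 0 l = toC (cmod (hatw nu (w j) 0 l)) * cexpi (beta j l).
Hypothesis polar_wu : forall j (u : 'cV[R]_n), (1 <= j <= q)%N ->
     rdot (hatw nu (w j)) (vC u)
       = toC (cmod (rdot (hatw nu (w j)) (vC u))) * cexpi (gamma j u).

Local Notation mult := (multiplicity lam).
Local Notation whu := (whu nu w).
Local Notation Th_m := (Th_m nu lam w v alpha beta).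
Local Notation Th_u := (Th_u nu lam v alpha gamma).

Lemma Re_lam j : (1 <= j <= q)%N -> complex.Re (lam j) = r j.
Proof.
by move=> /eig_lam[[_ _ H]|[_ _ _ H]]; have [_ []//] := H (lam j); left.
Qed.

Lemma is_cplxN j : (1 <= j <= q)%N -> is_cplx lam j = false -> complex.Im (lam j) = 0.
Proof. by move=> /eig_lam[[]//|[]]; rewrite /is_cplx => ->. Qed.

Lemma multiplicity_gt0 j : 0 < mult j.
Proof. by rewrite /multiplicity; case: ifP. Qed.

Lemma nu_v_gt0 j : (1 <= j <= q)%N -> 0 < nu (v j).
Proof.
move=> jq; case: nu_norm => nu0 nueq0 _ _; rewrite lt_neqAle nu0 andbT eq_sym.
apply/eqP => /nueq0 vj0; have := wv jq.
by rewrite /rdot vj0 mulmx0 mxE => /eqP; rewrite eq_sym oner_eq0.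
Qed.

Lemma rnorm_w_gt0 j : (1 <= j <= q)%N -> 0 < rnorm nu (w j).
Proof.
move=> jq; apply: rnorm_gt0 => //; apply/eqP => wj0; have := wv jq.
by rewrite /rdot wj0 mul0mx mxE => /eqP; rewrite eq_sym oner_eq0.
Qed.

Lemma fcond_gt0 j : (1 <= j <= q)%N -> 0 < fcond nu w v j.
Proof. by move=> jq; rewrite mulr_gt0 ?rnorm_w_gt0 ?nu_v_gt0. Qed.

Lemma toC_neq0 (x : R) : 0 < x -> toC x != 0.
Proof. by move=> x0; rewrite -cmod_eq0 cmod_toC normr_eq0 gt_eqF. Qed.

Lemma hatvE j k : (1 <= j <= q)%N -> v j k 0 = toC (nu (v j)) * hatv nu (v j) k 0.
Proof. by move=> jq; rewrite mxE mulVKf// toC_neq0// nu_v_gt0. Qed.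

Lemma hatwE j k : (1 <= j <= q)%N -> w j 0 k = toC (rnorm nu (w j)) * hatw nu (w j) 0 k.
Proof. by move=> jq; rewrite mxE mulVKf// toC_neq0// rnorm_w_gt0. Qed.

Lemma Re_polar (a b th1 th2 th3 : R) :
  complex.Re (cexpi th1 * (toC a * cexpi th2 * (toC b * cexpi th3))) =
  a * b * cos (th1 + th2 + th3).
Proof.
rewrite -!mulrA (mulrCA (cexpi th2)) (mulrCA (cexpi th1)) (mulrCA (cexpi th1)) cexpiM cexpiM.
by rewrite (toCM a) (toCM b) /= addrA mulrA.
Qed.

(** Polar angles add under multiplication, so the cosine matrix is the real part of a rotating
    rank-one matrix; this form can be multiplied by vectors and compared with the exponential. *)
Lemma Th_mE j t a b : (1 <= j <= q)%N -> Th_m j t a b =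
  complex.Re (cexpi (omega lam j * t) * (hatv nu (v j) a 0 * hatw nu (w j) 0 b)).
Proof. by move=> jq; rewrite polar_v// polar_w// Re_polar mxE. Qed.

Lemma Th_m_mulE j t (u : 'cV[R]_n) a b : (1 <= j <= q)%N -> (Th_m j t *m u) a b =
  complex.Re (cexpi (omega lam j * t) * (hatv nu (v j) a 0 * whu j u)).
Proof.
move=> jq; rewrite ord1 mxE [whu j u]mxE !mulr_sumr Re_sum; apply: eq_bigr => k _.
rewrite Th_mE// vCE.
set x := cexpi _; set y := hatv _ _ _ _; set z := hatw _ _ _ _.
rewrite (_ : x * (y * (z * _)) = toC (u k 0) * (x * (y * z))); last by ring.
by rewrite (toCM (u k 0)) /= mulrC.
Qed.

(** A real [u] passes through the real part, and the polar form of [whu j u] then supplies the angle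
    [gamma j u]. *)
Lemma Th_m_mul j t (u : 'cV[R]_n) : (1 <= j <= q)%N ->
  Th_m j t *m u = cmod (whu j u) *: Th_u j t u.
Proof.
move=> jq; apply/matrixP => a b; rewrite Th_m_mulE// ord1 [RHS]mxE [X in _ = _ * X]mxE.
have pwu : whu j u = toC (cmod (whu j u)) * cexpi (gamma j u) by exact: polar_wu.
by rewrite [in LHS]polar_v// [in LHS]pwu Re_polar; ring.
Qed.

(** The spectral formula for powers is inserted into the exponential series, and each mode converges
    by [exp_series_cvg]; normalizing [v j] and [w j] releases the factor [fcond]. *)
Lemma expm_Th t : expm t A =
  \sum_(1 <= j < q.+1) (mult j * (expR (r j * t) * fcond nu w v j)) *: Th_m j t.
Proof.
have sum_cvg (I : Type) (s : seq I) (f : I -> nat -> R) (l : I -> R) :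
    (forall i, f i @ \oo --> l i)%classic ->
    ((fun N => \sum_(i <- s) f i N) @ \oo --> \sum_(i <- s) l i)%classic.
  move=> fl; elim: s => [|i s IH].
    rewrite big_nil (_ : (fun _ => _) = fun=> 0); first exact: cvg_cst.
    by apply/funext => N; rewrite big_nil.
  rewrite big_cons (_ : (fun _ => _) = (fun N => f i N + \sum_(i <- s) f i N)).
    exact: cvgD.
  by apply/funext => N; rewrite big_cons.
apply/matrixP => a b; rewrite summxE mxE; apply: cvg_lim => //.
rewrite (_ : (fun _ => _) = (fun N => \sum_(1 <= j < q.+1)
   mult j * \sum_(k < N) t ^+ k / k`!%:R * complex.Re (lam j ^+ k * (v j a 0 * w j 0 b)))).
  rewrite (_ : \sum_(1 <= j < q.+1) _ = \sum_(1 <= j < q.+1)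
    mult j * (expR (complex.Re (lam j) * t) *
      complex.Re (cexpi (complex.Im (lam j) * t) * (v j a 0 * w j 0 b)))).
    by apply: sum_cvg => j; apply: cvgMr; exact: exp_series_cvg.
  apply: eq_big_nat => j; rewrite ltnS => jq.
  rewrite mxE Th_mE// Re_lam// -mulrA -mulrA; congr (_ * (_ * _)).
  rewrite hatvE// hatwE// -/(omega lam j).
  set x := cexpi _; set y := hatv _ _ _ _; set z := hatw _ _ _ _.
  have -> : x * (toC (nu (v j)) * y * (toC (rnorm nu (w j)) * z)) =
      toC (fcond nu w v j) * (x * (y * z)).
    rewrite (_ : toC (fcond _ _ _ _) = toC (rnorm nu (w j)) * toC (nu (v j))); first by ring.
    by rewrite /fcond /toC; simpc.
  by rewrite (toCM (fcond _ _ _ _)).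
(* At the level of partial sums, exchanging the sums over modes and powers is a finite operation. *)
apply/funext => N; under [RHS]eq_bigr do rewrite mulr_sumr.
rewrite exchange_big; apply: eq_bigr => k _ /=.
rewrite (spectral_exp r_decr eig_r eig_lam wA Av wv k) summxE mulr_sumr.
by apply: eq_bigr => j _; rewrite !mxE mulrCA.
Qed.

(** Here [omega] vanishes and all data are real, so the mode is the constant rank-one matrix of hat
    v and hat w, and hat v has norm 1. *)
Lemma nuR_Th_m_real j t (u : 'cV[R]_n) : (1 <= j <= q)%N -> is_cplx lam j = false ->
  nuR nu (Th_m j t *m u) = cmod (whu j u).
Proof.
move=> jq jr; have im0 := is_cplxN jq jr; have [/forallP wR vR] := real_wv jq im0.
have hvR k : complex.Im (hatv nu (v j) k 0) = 0.
  by rewrite mxE toC_invM /= vR mulr0.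
have hwR k : complex.Im (hatw nu (w j) 0 k) = 0.
  by rewrite mxE toC_invM /= (eqP (wR k)) mulr0.
have whuR : complex.Im (whu j u) = 0.
  rewrite [whu j u]mxE Im_sum big1// => k _; rewrite ImM hwR mul0r addr0.
  by rewrite vCE /= mulr0.
have RM (z1 z2 : R[i]) : complex.Im z1 = 0 -> complex.Im z2 = 0 ->
    toC (complex.Re (z1 * z2)) = z1 * z2.
  by case: z1 z2 => [x1 y1] [x2 y2] /= -> ->; rewrite /toC; simpc.
have cexpi0 : cexpi 0 = 1 :> R[i] by rewrite /cexpi cos0 sin0.
have vE : vC (Th_m j t *m u) = whu j u *: hatv nu (v j).
  apply/matrixP => a b; rewrite ord1 [RHS]mxE [LHS]mxE -RM// Th_m_mulE//.
  by rewrite /omega im0 mul0r cexpi0 mul1r mulrC.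
rewrite /nuR vE; case: nu_norm => nu0 _ nuZ _; rewrite nuZ /hatv nuZ.
have vp := nu_v_gt0 jq.
rewrite -[X in _ * (_ * X)]ger0_norm ?ltW// -cmod_toC -cmodM mulVf ?toC_neq0//.
by rewrite (cmod_toC (1 : R)) normr1 mulr1.
Qed.

(** For a real row [rnorm] is a supremum over the same real sphere as [mnorm], so the matrix norm is
    the norm of hat w. *)
Lemma mnorm_Th_m_real j t (u0 : 'cV[R]_n) : nuR nu u0 = 1 ->
  (1 <= j <= q)%N -> is_cplx lam j = false -> mnorm nu (Th_m j t) = 1.
Proof.
move=> u01 jq jr; have im0 := is_cplxN jq jr; have [wR vR] := real_wv jq im0.
have wp := rnorm_w_gt0 jq; have [b _ hb] := rdot_bounded nu_norm (w j).
transitivity ((rnorm nu (w j))^-1 * rnorm nu (w j)); last by rewrite mulVf// gt_eqF.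
rewrite [X in _ = _ * X]/rnorm wR -(@sup_imageZ _ _ _ _ b); last first.
- by move=> u /= u1; rewrite (le_trans (hb _))// [nu _]u1 mulr1.
- by exists u0.
- by rewrite invr_ge0 ltW.
congr sup; apply: eq_imagel => u _.
rewrite nuR_Th_m_real// /Defs.whu /hatw /rdot -scalemxAl mxE cmodM; congr (_ * _).
apply: (mulIf (lt0r_neq0 wp)); rewrite mulVf ?gt_eqF//.
rewrite -[X in _ * X]ger0_norm ?ltW// -cmod_toC -cmodM mulVf ?toC_neq0//.
by rewrite (cmod_toC (1 : R)) normr1.
Qed.

(** If the mode vanished at [u], a multiple of [v j] would be ['i] times a real
    vector, and a real eigenvector of [A] cannot have a nonreal eigenvalue. *)
Lemma Th_m_mul_neq0 j t (u : 'cV[R]_n) : (1 <= j <= q)%N -> is_cplx lam j ->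
  whu j u != 0 -> Th_m j t *m u != 0.
Proof.
move=> jq jc wu0; rewrite /is_cplx in jc; apply/eqP => Tu0.
pose e := cexpi (omega lam j * t) * whu j u.
have e0 : e != 0.
  by rewrite mulf_neq0// -cmod_eq0 cmod_cexpi oner_eq0.
have ReTu a : complex.Re (e * hatv nu (v j) a 0) = 0.
  by rewrite /e -mulrA (mulrC (whu j u)) -(Th_m_mulE t u a 0 jq) Tu0 mxE.
pose y : 'cV[R]_n := \col_a complex.Im (e * hatv nu (v j) a 0).
have yE : e *: hatv nu (v j) = Complex 0 1 *: vC y.
  apply/matrixP => a b; rewrite ord1 [LHS]mxE [RHS]mxE vCE [y a 0]mxE; have := ReTu a.
  by case: (e * _) => x1 x2 /= ->; rewrite /toC; simpc.
have Ay : mC A *m vC y = lam j *: vC y.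
  have i0 : Complex 0 1 != 0 :> R[i] by rewrite eq_complex /= oner_eq0 andbF.
  have : mC A *m (e *: hatv nu (v j)) = lam j *: (e *: hatv nu (v j)).
    by rewrite /hatv -!scalemxAr Av// !scalerA; congr (_ *: _); ring.
  by rewrite yE -scalemxAr scalerA mulrC -scalerA => /(scalerI i0).
(* The left side of [Ay] has zero imaginary part, so Im(lam j) times [y] vanishes. *)
have y0 : y = 0.
  apply/matrixP => a b; rewrite ord1 [RHS]mxE.
  move/matrixP: Ay => /(_ a 0) /(congr1 (@complex.Im R)).
  rewrite [X in _ = _ X -> _]mxE ImM vCE.
  rewrite /= mulr0 add0r mxE Im_sum big1 => [/esym/eqP|k _].
    by rewrite mulf_eq0 gt_eqF//= => /eqP.
  by rewrite ImM !mxE /= mulr0 mul0r addr0.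
have : nu (e *: hatv nu (v j)) = 0.
  case: (nu_norm) => _ _ nuZ _; rewrite yE y0 nuZ.
  by rewrite -[nu (vC 0)]/(nuR nu 0) (nuR0 nu_norm) mulr0.
case: nu_norm => nu0 _ nuZ _; rewrite nuZ /hatv nuZ => /eqP.
rewrite !mulf_eq0 !cmod_eq0 (negbTE e0) invr_eq0 (negbTE (toC_neq0 (nu_v_gt0 jq))) /=.
by rewrite gt_eqF// nu_v_gt0.
Qed.

Lemma nuR_Th_m j t (u : 'cV[R]_n) : (1 <= j <= q)%N ->
  nuR nu (Th_m j t *m u) = cmod (whu j u) * nuR nu (Th_u j t u).
Proof. by move=> jq; rewrite Th_m_mul// (nuRZ nu_norm) ger0_norm ?cmod_ge0. Qed.

Lemma nuR_Th_m_gt0 j t (u : 'cV[R]_n) : (1 <= j <= q)%N -> whu j u != 0 ->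
  0 < nuR nu (Th_m j t *m u).
Proof.
move=> jq wu0; have [jc|jr] := boolP (is_cplx lam j).
  exact/(nuR_gt0 nu_norm)/Th_m_mul_neq0.
by rewrite nuR_Th_m_real ?(negbTE jr)// lt_neqAle cmod_ge0 eq_sym cmod_eq0 wu0.
Qed.

Lemma nuR_Th_mE j t (u : 'cV[R]_n) : (1 <= j <= q)%N -> nuR nu (Th_m j t *m u) =
  if is_cplx lam j then cmod (whu j u) * nuR nu (Th_u j t u) else cmod (whu j u).
Proof. by move=> jq; case: ifP => c; [exact: nuR_Th_m|exact: nuR_Th_m_real]. Qed.

(** * Relative errors and condition numbers *)

Hypothesis q_gt0 : (0 < q)%N.

Let q1 : (1 <= 1 <= q)%N. Proof. exact: q_gt0. Qed.

Definition mode_coef t j : R := mult j * (expR (r j * t) * fcond nu w v j).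

Lemma mode_coef_gt0 t j : (1 <= j <= q)%N -> 0 < mode_coef t j.
Proof.
move=> jq; apply: mulr_gt0; first exact: multiplicity_gt0.
by apply: mulr_gt0; [exact: expR_gt0|exact: fcond_gt0].
Qed.

Lemma expm_split t : expm t A = mode_coef t 1 *: Th_m 1 t +
  \sum_(2 <= j < q.+1) mode_coef t j *: Th_m j t.
Proof. by rewrite expm_Th big_ltn ?ltnS. Qed.

(** Puts [eps_u] in the shape of the bound in [seminorm_perturbation]. *)
Lemma eps_uE t (u : 'cV[R]_n) : whu 1 u != 0 -> eps_u nu q r lam w v alpha gamma t u =
  \sum_(2 <= j < q.+1) nuR nu (mode_coef t j *: (Th_m j t *m u)) /
    nuR nu (mode_coef t 1 *: (Th_m 1 t *m u)).
Proof.
move=> wu0; apply: eq_big_nat => j /andP[j2]; rewrite ltnS => jq'.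
have jq : (1 <= j <= q)%N by rewrite jq' (ltnW j2).
have N1 := nuR_Th_m_gt0 t q1 wu0.
rewrite !(nuRZ nu_norm) !gtr0_norm ?mode_coef_gt0// /mode_coef /multiplicity.
rewrite mulrBl expRD expRN /G_u !nuR_Th_mE//.
rewrite nuR_Th_mE// in N1.
apply: G_term; rewrite ?cmod_eq0//.
- by rewrite gt_eqF ?expR_gt0.
- by rewrite gt_eqF ?fcond_gt0.
by move=> c; move: N1; rewrite c; apply: contraTneq => ->; rewrite mulr0 ltxx.
Qed.

Lemma eps_mE t (u : 'cV[R]_n) : nuR nu u = 1 -> 0 < mnorm nu (Th_m 1 t) ->
  eps_m nu q r lam w v alpha beta t =
  \sum_(2 <= j < q.+1) mnorm nu (mode_coef t j *: Th_m j t) /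
    mnorm nu (mode_coef t 1 *: Th_m 1 t).
Proof.
move=> u1 /lt0r_neq0 N1; apply: eq_big_nat => j /andP[j2]; rewrite ltnS => jq'.
have jq : (1 <= j <= q)%N by rewrite jq' (ltnW j2).
rewrite !(mnormZ nu_norm u1) !gtr0_norm ?mode_coef_gt0// /mode_coef /multiplicity.
rewrite mulrBl expRD expRN /G_m.
(* The factor [1 *] matches the pattern of [G_term] with [cj] and [c1] both equal to 1. *)
have mnorm_Th_mE i : (1 <= i <= q)%N -> mnorm nu (Th_m i t) =
    if is_cplx lam i then 1 * mnorm nu (Th_m i t) else 1.
  by move=> iq; case: ifP => c; [rewrite mul1r|exact: mnorm_Th_m_real u1 iq c].
rewrite [X in _ = _ * X / _](mnorm_Th_mE _ jq) [X in _ = _ / (_ * X)](mnorm_Th_mE _ q1).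
rewrite -G_term ?oner_eq0// ?divr1 ?mulr1//.
- by rewrite gt_eqF ?expR_gt0.
- by rewrite gt_eqF ?fcond_gt0.
Qed.

Lemma nuR_expm t (u : 'cV[R]_n) : whu 1 u != 0 -> exists chi,
  nuR nu (expm t A *m u) = mode_coef t 1 * nuR nu (Th_m 1 t *m u) * (1 + chi) /\
  `|chi| <= eps_u nu q r lam w v alpha gamma t u.
Proof.
move=> wu0; rewrite eps_uE// expm_split mulmxDl mulmx_suml -scalemxAl.
under eq_bigr do rewrite -scalemxAl.
rewrite -[mode_coef t 1 * _](_ : nuR nu (mode_coef t 1 *: (Th_m 1 t *m u)) = _).
  apply: seminorm_perturbation (nuRZ nu_norm) (nuRD nu_norm) _.
  by rewrite (nuRZ nu_norm) mulr_gt0 ?normr_gt0 ?nuR_Th_m_gt0// gt_eqF ?mode_coef_gt0.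
by rewrite (nuRZ nu_norm) gtr0_norm ?mode_coef_gt0.
Qed.

Lemma mnorm_expm t (u : 'cV[R]_n) : nuR nu u = 1 -> 0 < mnorm nu (Th_m 1 t) -> exists chi,
  mnorm nu (expm t A) = mode_coef t 1 * mnorm nu (Th_m 1 t) * (1 + chi) /\
  `|chi| <= eps_m nu q r lam w v alpha beta t.
Proof.
move=> u1 M1; rewrite (eps_mE u1 M1) expm_split.
rewrite -[mode_coef t 1 * _](_ : mnorm nu (mode_coef t 1 *: Th_m 1 t) = _).
  apply: seminorm_perturbation (mnormZ nu_norm u1) (mnormD nu_norm u1) _.
  by rewrite (mnormZ nu_norm u1) mulr_gt0 ?normr_gt0// gt_eqF ?mode_coef_gt0.
by rewrite (mnormZ nu_norm u1) gtr0_norm ?mode_coef_gt0.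
Qed.

(** The asymptotic condition number is the one obtained by keeping the first mode alone. *)
Lemma Kinf_zE t (y0 z0 : 'cV[R]_n) : Kinf_z nu lam w v alpha gamma t y0 z0 =
  nuR nu (Th_m 1 t *m z0) / nuR nu (Th_m 1 t *m unitv nu y0).
Proof.
rewrite /Kinf_z; case c: (is_cplx lam 1); last by rewrite !nuR_Th_m_real.
by rewrite !nuR_Th_m// invfM mulrACA.
Qed.

Lemma Kinf_mE t (y0 u : 'cV[R]_n) : nuR nu u = 1 ->
  Kinf_m nu lam w v alpha beta gamma t y0 =
  mnorm nu (Th_m 1 t) / nuR nu (Th_m 1 t *m unitv nu y0).
Proof.
move=> u1; rewrite /Kinf_m; case c: (is_cplx lam 1).
  by rewrite nuR_Th_m// invfM mulrACA mul1r.
by rewrite nuR_Th_m_real// (mnorm_Th_m_real _ u1).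
Qed.

Lemma whu_neq0 j (u : 'cV[R]_n) : (1 <= j <= q)%N -> rdot (w j) (vC u) != 0 -> whu j u != 0.
Proof.
move=> jq wu; rewrite /Defs.whu /hatw /rdot -scalemxAl mxE mulf_neq0//.
by rewrite invr_neq0// toC_neq0// rnorm_w_gt0.
Qed.

End Expansion.

Theorem theorem11 (R : realType) (n : nat) (nu : 'cV[R[i]]_n -> R)
  (A : 'M[R]_n) (q : nat) (r : nat -> R) (lam : nat -> R[i])
  (w : nat -> 'rV[R[i]]_n) (v : nat -> 'cV[R[i]]_n)
  (alpha beta : nat -> 'I_n -> R) (gamma : nat -> 'cV[R]_n -> R)
  (y0 z0 : 'cV[R]_n) :
  is_vnorm nu ->
  (0 < q)%N ->
  (* r_1 > r_2 > ... > r_q *)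
  (forall j, (1 <= j < q)%N -> r j.+1 < r j) ->
  (* every eigenvalue of A has real part among r_1, ..., r_q *)
  (forall mu : R[i], eigenvalue (mC A) mu ->
     exists j, (1 <= j <= q)%N /\ complex.Re mu = r j) ->
  (* each Lambda_j is real or complex, with lambda_j as in the context *)
  (forall j, (1 <= j <= q)%N ->
     Lambda_real A (r j) (lam j) \/ Lambda_complex A (r j) (lam j)) ->
  (* left and right eigenvectors, normalized by w^(j) v^(j) = 1 *)
  (forall j, (1 <= j <= q)%N -> w j *m mC A = lam j *: w j) ->
  (forall j, (1 <= j <= q)%N -> mC A *m v j = lam j *: v j) ->
  (forall j, (1 <= j <= q)%N -> rdot (w j) (v j) = 1) ->
  (* real eigenvectors in the real case *)
  (forall j, (1 <= j <= q)%N -> complex.Im (lam j) = 0 ->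
     is_real_row (w j) /\ (forall k, complex.Im (v j k 0) = 0)) ->
  (* polar forms of hat v^(j)_k, hat w^(j)_l, hat w^(j) u *)
  (forall j k, (1 <= j <= q)%N ->
     hatv nu (v j) k 0 = toC (cmod (hatv nu (v j) k 0)) * cexpi (alpha j k)) ->
  (forall j l, (1 <= j <= q)%N ->
     hatw nu (w j) 0 l = toC (cmod (hatw nu (w j) 0 l)) * cexpi (beta j l)) ->
  (forall j (u : 'cV[R]_n), (1 <= j <= q)%N ->
     rdot (hatw nu (w j)) (vC u)
       = toC (cmod (rdot (hatw nu (w j)) (vC u))) * cexpi (gamma j u)) ->
  rdot (w 1%N) (vC y0) != 0 ->
  rdot (w 1%N) (vC z0) != 0 ->
  nuR nu z0 = 1 ->
  forall t : R,
  let yh := unitv nu y0 in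
  let eps_y := eps_u nu q r lam w v alpha gamma t yh in
  let eps_z := eps_u nu q r lam w v alpha gamma t z0 in
  eps_y < 1 ->
  approx_prec (Kz nu A t y0 z0) (Kinf_z nu lam w v alpha gamma t y0 z0)
              ((eps_z + eps_y) / (1 - eps_y)) /\
  approx_prec (Km nu A t y0) (Kinf_m nu lam w v alpha beta gamma t y0)
              ((eps_m nu q r lam w v alpha beta t + eps_y) / (1 - eps_y)).
Proof.
move=> nu_norm q0 r_decr eig_r eig_lam wA Av wv real_wv polar_v polar_w polar_wu
  wy0 wz0 z1 t yh eps_y eps_z eps_y1.
have q1 : (1 <= 1 <= q)%N by [].
have y0_neq0 : y0 != 0.
  apply: contraNneq wy0 => ->; rewrite /rdot (_ : vC 0 = 0) ?mulmx0 ?mxE//.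
  by apply/matrixP => a b; rewrite !mxE.
have y0_gt0 := nuR_gt0 nu_norm y0_neq0.
have hz : whu nu w 1 z0 != 0 := whu_neq0 nu_norm wv q1 wz0.
have hy : whu nu w 1 yh != 0.
  apply: (whu_neq0 nu_norm wv q1).
  rewrite /rdot /yh /unitv vC_scale -scalemxAr mxE mulf_neq0//.
  by rewrite toC_neq0// invr_gt0.
pose N u := nuR nu (Th_m nu lam w v alpha beta 1 t *m u).
have N_gt0 u : whu nu w 1 u != 0 -> 0 < N u :=
  nuR_Th_m_gt0 nu_norm eig_lam Av wv real_wv polar_v polar_w t q1.
have Ny := N_gt0 _ hy; have Nz := N_gt0 _ hz.
(* The first mode does not vanish at [z0], so its matrix norm is positive; the unit vector [z0] also
   witnesses a nonempty sphere. *)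
have M1 : 0 < mnorm nu (Th_m nu lam w v alpha beta 1 t).
  apply: (mnorm_gt0 nu_norm z1 (u := z0)); apply: contraTneq Nz => Nz0.
  by rewrite /N Nz0 (nuR0 nu_norm) ltxx.
have a0 := mode_coef_gt0 r lam nu_norm wv t q1.
have nE u := nuR_expm nu_norm r_decr eig_r eig_lam wA Av wv real_wv
  polar_v polar_w polar_wu q0 t (u := u).
have [chiy [ey hchiy]] := nE _ hy; have [chiz [ez hchiz]] := nE _ hz.
have [chim [em hchim]] := mnorm_expm nu_norm r_decr eig_r eig_lam wA Av wv real_wv
  polar_v polar_w q0 z1 M1.
split.
  rewrite /Kz ez ey (Kinf_zE nu_norm eig_lam wv real_wv polar_v polar_w polar_wu q0).
  exact: approx_prec_ratio.
rewrite /Km em ey (Kinf_mE nu_norm eig_lam wv real_wv polar_v polar_w polar_wu q0 _ _ z1).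
exact: approx_prec_ratio.
Qed.
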